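(* Let $G$ be a finite group. If $T(G)>\frac12|G|$, then $G$ is supersolvable.
   Context: For a finite group $G$, $\mathrm{Irr}(G)$ denotes the set of irreducible complex characters of $G$, and $T(G)=\sum_{\chi\in\mathrm{Irr}(G)}\chi(1)$ is the sum of their degrees. A group is supersolvable if it has a finite series of subgroups from $1$ to $G$, each normal in $G$, with cyclic successive quotients. *)

(* Defs.v *)
From mathcomp Require Import all_boot all_order all_algebra all_fingroup.
From mathcomp Require Import all_solvable all_field all_character.

Set Implicit Arguments.
Unset Strict Implicit.
Unset Printing Implicit Defensive.

Import Order.TTheory GRing.Theory Num.Theory.
Local Open Scope ring_scope.

(* The quotient is a genuine one: H <| G and H \subset K \subset G give
   H <| K. *)
Definition supersolvable_step (gT : finGroupType) (G H K : {group gT}) : bool :=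
  [&& H <| G, K <| G, H \subset K & cyclic (K / H)]%g.

Definition supersolvable (gT : finGroupType) (G : {group gT}) : Prop :=
  exists2 s : seq {group gT},
    path (supersolvable_step G) 1%G s & last 1%G s = G.

(* Characters take values in algC, the algebraic complex numbers; this loses
   nothing since all complex characters of finite groups are algebraic-valued. *)
Definition char_degree_sum (gT : finGroupType) (G : {group gT}) : algC :=
  \sum_(i : Iirr G) 'chi[G]_i 1%g.

(* Main.v *)
Require Import Defs.
From mathcomp Require Import all_boot all_order all_algebra all_fingroup.
From mathcomp Require Import all_solvable all_field all_character.
From mathcomp Require Import ring zify.

(* By induction on |G|.  Since |G| is the sum of the chi(1)^2, the hypothesis
   says that the sum of the chi(1) (2 - chi(1)) is positive, a condition that
   passes to G / N for every normal N <= G'.  If G is not abelian, let N <= G'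
   be a minimal normal subgroup of G; it suffices that N is cyclic.  The bound
   T(G) <= |G : N| T(N) gives T(N) > |N| / 2, hence N' < N and N is abelian.
   If N is not cyclic, all nontrivial G-orbits on Irr(N) have size at least 3,
   so by Clifford's theorem each nontrivial lambda contributes at most
   |G : N| / 3 to the sum T(G) of the <Res chi, lambda>.  Thus
   T(G) <= |G : N| (|N| + 2) / 3 <= |G| / 2, because |N| >= 4. *)

Import Order.TTheory GRing.Theory Num.Theory.
Local Open Scope ring_scope.

Lemma char_degree_sum_gt_half (gT : finGroupType) (G : {group gT}) :
  (2^-1 * #|G|%:R < char_degree_sum G) =
    (0 < \sum_i 'chi[G]_i 1%g * (2 - 'chi_i 1%g)).
Proof.
rewrite mulrC ltr_pdivrMr ?ltr0n // -subr_gt0 -irr_sum_square mulr_suml.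
by rewrite -sumrB; under eq_bigr => i _ do rewrite expr2 -mulrBr.
Qed.

Lemma nonlinear_irr1_ge2 (gT : finGroupType) (G : {group gT}) (i : Iirr G) :
  'chi_i \isn't a linear_char -> 2 <= 'chi_i 1%g.
Proof.
rewrite qualifE /= irr_char /=; have := irr1_gt0 i.
by have /natrP[[|[|n]] ->] := Cnat_irr1 i; rewrite ?ltxx ?eqxx // ler_nat.
Qed.

(** Every irreducible character of [G] is a constituent of one induced from an irreducible character
    of [H], so [T(G)] is at most the sum of the degrees of these induced characters. *)
Lemma char_degree_sum_subgroup (gT : finGroupType) (G H : {group gT}) :
  H \subset G -> char_degree_sum G <= #|G : H|%g%:R * char_degree_sum H.
Proof.
move=> sHG; rewrite /char_degree_sum mulr_sumr.
rewrite [leRHS](eq_bigr (fun j => \sum_i '['Ind[G] 'chi[H]_j, 'chi_i] * 'chi_i 1%g)).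
  rewrite exchange_big ler_sum //= => i _; rewrite -mulr_suml.
  rewrite -{1}['chi_i 1%g]mul1r ler_wpM2r ?char1_ge0 ?irr_char //.
  have [j iHj] := neq0_has_constt (Res_irr_neq0 H i).
  have nneg k : '['Ind[G] 'chi[H]_k, 'chi_i] \in Num.nat.
    by rewrite Cnat_cfdot_char ?cfInd_char ?irr_char.
  rewrite (bigD1 j) //= ler_wpDr ?sumr_ge0 // => [k _|].
    by rewrite natr_ge0.
  rewrite -constt_Ind_Res irr_consttE in iHj.
  by have /natrP[[|n] En] := nneg j; rewrite En ?eqxx ?ler1n // in iHj *.
move=> j _; rewrite -cfInd1 // {1}['Ind _]cfun_sum_cfdot sum_cfunE.
by apply: eq_bigr => i _; rewrite cfunE.
Qed.

Lemma char_degree_sum_gt_half_sub (gT : finGroupType) (G H : {group gT}) :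
    H \subset G -> 2^-1 * #|G|%:R < char_degree_sum G ->
  2^-1 * #|H|%:R < char_degree_sum H.
Proof.
move=> sHG /lt_le_trans/(_ (char_degree_sum_subgroup _ _ _ sHG)).
by rewrite -(Lagrange sHG) mulnC natrM mulrCA ltr_pM2l ?gt0CiG.
Qed.

(* Dropping characters of degree at least 2 does not decrease the sum of the
   chi(1) (2 - chi(1)), and all linear characters survive in G / N. *)
Lemma char_degree_sum_gt_half_quotient (gT : finGroupType) (G N : {group gT}) :
    (N <| G)%g -> N \subset G^`(1)%g -> 2^-1 * #|G|%:R < char_degree_sum G ->
  2^-1 * #|(G / N)%g|%:R < char_degree_sum (G / N).
Proof.
move=> nsNG sNG'; rewrite !char_degree_sum_gt_half.
move=> /lt_le_trans; apply; rewrite (bigID (fun i => N \subset cfker 'chi_i)) /=.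
rewrite -lerBrDl (reindex _ (mod_Iirr_bij nsNG)) /=.
rewrite [X in _ - X](eq_big (fun=> true) (fun i =>
  'chi[(G / N)%g]_i 1%g * (2 - 'chi_i 1%g))) => [||i _]; first last.
- by rewrite mod_IirrE // cfMod1.
- by move=> i; rewrite mod_IirrE // cfker_mod.
rewrite subrr sumr_le0 // => i kerN'i; rewrite mulr_ge0_le0 //.
  by rewrite char1_ge0 ?irr_char.
rewrite subr_le0 nonlinear_irr1_ge2 // lin_irr_der1.
by apply: contra kerN'i; apply: subset_trans.
Qed.

(* If G is perfect, its only linear character is 1, so the hypothesis forces all
   other irreducible characters to have degree 2; then |G| is congruent to
   1 mod 4, yet divisible by 2. *)
Lemma char_degree_sum_gt_half_der1 (gT : finGroupType) (G : {group gT}) :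
    G :!=: 1%g -> 2^-1 * #|G|%:R < char_degree_sum G ->
  G^`(1)%g != G.
Proof.
move=> ntG; rewrite char_degree_sum_gt_half; apply: contraTneq => perfG.
have deg_ge2 i : i != 0 -> 2 <= 'chi[G]_i 1%g.
  by move=> nz_i; rewrite nonlinear_irr1_ge2 // lin_irr_der1 perfG subGcfker.
have term_le0 i : i != 0 -> 'chi[G]_i 1%g * (2 - 'chi_i 1%g) <= 0.
  by move=> nz_i; rewrite mulr_ge0_le0 ?char1_ge0 ?irr_char ?subr_le0 ?deg_ge2.
have [deg2 | ] := boolP [forall (i | i != 0), 'chi[G]_i 1%g == 2].
  have nt_irr : exists i : Iirr G, i != 0.
    apply/existsP; apply: contraR ntG; rewrite negb_exists => /forallP irr0G.
    rewrite -subG1 -(TI_cfker_irr G); apply/bigcapsP => i _.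
    by rewrite subGcfker; apply/negbNE/irr0G.
  have [i nz_i] := nt_irr; have : (2 %| #|G|)%N.
    rewrite -dvdC_nat; have := dvd_irr1_cardG i.
    by rewrite (eqP (forall_inP deg2 i nz_i)).
  have: #|G|%:R = (1 + (Nirr G).-1 * 4)%:R :> algC.
    rewrite -irr_sum_square (bigD1 0) //= irr0 cfun11 expr1n natrD; congr (_ + _).
    rewrite (eq_bigr (fun=> 4%:R)) => [|k nz_k]; last first.
      by rewrite (eqP (forall_inP deg2 k nz_k)) -natrX.
    by rewrite sumr_const cardC1 card_ord natrM mulr_natl.
  by move/eqP; rewrite eqr_nat => /eqP->; rewrite dvdn_addl ?dvdn_mull.
rewrite negb_forall_in => /exists_inP[i nz_i deg_i].
rewrite (bigD1 0) // (bigD1 i) //= irr0 cfun11 mul1r addrA.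
(* The trivial character contributes only 1, which a degree [n >= 3] outweighs since
   [n (2 - n) <= -3]. *)
suff le_sum: 2 - 1 + 'chi_i 1%g * (2 - 'chi_i 1%g) <= 0 :> algC.
  rewrite le_gtF // -[leRHS]addr0 lerD // sumr_le0 // => k /andP[nz_k _].
  exact: term_le0.
have := deg_ge2 i nz_i; have /natrP[n En] := Cnat_irr1 i.
rewrite En ler_nat in deg_i * => le2n.
have lt2n : (2 < n)%N by rewrite ltn_neqAle le2n eq_sym -(eqr_nat algC) deg_i.
rewrite -(subnKC lt2n) natrD; set m := (n - 3)%N.
rewrite -oppr_ge0 [leRHS](_ : _ = (2 + 4 * m + m * m)%:R) ?ler0n //.
by rewrite !natrD !natrM; ring.
Qed.

(** By minimality the invariant proper kernel is trivial, and a group with a faithful irreducible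
    character has cyclic center. *)
Lemma minnormal_irr_ker_cyclic (gT : finGroupType) (G N : {group gT})
    (j : Iirr N) :
    minnormal N G -> abelian N -> j != 0 -> G \subset 'N(cfker 'chi_j)%g ->
  cyclic N.
Proof.
case/mingroupP=> _ minN abN nz_j nKG; rewrite -(center_idP abN).
apply: (@irr_faithful_center _ N j); rewrite cfaithfulE subG1.
apply: contraR nz_j => ntK; rewrite -subGcfker.
by rewrite (minN [group of cfker 'chi_j]) ?cfker_sub //= ntK.
Qed.

(** Conjugation by an element of [G] is injective and maps the orbit into itself, so it only
    permutes the factors. *)
Lemma prod_cfclass_invariant (gT : finGroupType) (G N : {group gT})
    (phi : 'CF(N)) :
  (N <| G)%g -> G \subset 'I[(\prod_(psi <- (phi ^: G)%CF) psi)%R]%g.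
Proof.
move=> nsNG; have nNG := normal_norm nsNG.
apply/subsetP=> x Gx; rewrite inE (subsetP nNG) //= rmorph_prod /=.
apply/eqP; rewrite -(big_map (cfConjg x) xpredT id) /=; apply: perm_big.
have Uphi := cfclass_uniq phi nsNG.
have inj_x : injective (cfConjg x : 'CF(N) -> 'CF(N)) := can_inj (cfConjgK x).
have Uphix : uniq (map (cfConjg x) (phi ^: G)%CF) by rewrite map_inj_uniq.
have sub_x : {subset map (cfConjg x) (phi ^: G)%CF <= (phi ^: G)%CF}.
  move=> _ /mapP[_ /cfclassP[y Gy ->] ->]; apply/cfclassP.
  by exists (y * x)%g; rewrite ?groupM // (cfConjgM phi nsNG).
have le_size := eq_leq (esym (size_map (cfConjg x) (phi ^: G)%CF)).
have [_ eq_mem] := uniq_min_size Uphix sub_x le_size.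
exact: uniq_perm.
Qed.

(* An orbit of size at most 2 is {lambda} or {lambda, mu}, and the product of
   its members is invariant, so it is trivial if N is not cyclic; then
   mu = lambda^-1, so the kernel of lambda is invariant. *)
Lemma minnormal_noncyclic_orbit (gT : finGroupType) (G N : {group gT})
    (j : Iirr N) :
    (N <| G)%g -> minnormal N G -> abelian N -> ~~ cyclic N -> j != 0 ->
  (3 <= size ('chi_j ^: G)%CF)%N.
Proof.
move=> nsNG minN abN ncycN nz_j; have nNG := normal_norm nsNG.
have lin_irr k : 'chi[N]_k \is a linear_char by apply/char_abelianP.
have ncycP k : G \subset 'N(cfker 'chi[N]_k)%g -> k = 0.
  move=> nKG; apply: contraNeq ncycN => nz_k.
  exact: minnormal_irr_ker_cyclic nKG.
have lin_class psi : psi \in ('chi_j ^: G)%CF -> psi \is a linear_char.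
  by case/cfclassP=> x _ ->; rewrite cfConjg_lin_char.
have prod1 : \prod_(psi <- ('chi_j ^: G)%CF) psi = 1.
  have lin_mu : \prod_(psi <- ('chi_j ^: G)%CF) psi \is a linear_char.
    by rewrite big_seq rpred_prod.
  have := prod_cfclass_invariant _ G N 'chi_j nsNG.
  (* The product is itself an irreducible character; being invariant, it has an invariant kernel, so
     [ncycP] applies. *)
  have [k ->] := irrP (lin_char_irr lin_mu) => /subsetP invk.
  rewrite [k]ncycP ?irr0 //; apply/subsetP=> x /invk Ix.
  by rewrite inE -cfker_conjg ?(subsetP (norm_inertia _) x Ix) ?inertiaJ.
rewrite ltnNge; apply: contra nz_j => small; apply/eqP/ncycP/subsetP=> x Gx.
rewrite inE -cfker_conjg ?(subsetP nNG) //.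
have jx_in : ('chi_j ^ x)%CF \in ('chi_j ^: G)%CF by apply/cfclassP; exists x.
have := cfclass_refl G 'chi_j; move: jx_in prod1 lin_class small.
case: ('chi_j ^: G)%CF => [|a [|b []]] //= jx_in prod1 lin_class _ j_in.
  by move: jx_in j_in; rewrite !inE => /eqP-> /eqP->.
have lin_a : a \is a linear_char by rewrite lin_class ?mem_head.
have Db : b = (a^*)%CF.
  rewrite -invr_lin_char //; apply: (mulrI (lin_char_unitr lin_a)).
  by rewrite divrr ?lin_char_unitr // -prod1 !big_cons big_nil mulr1.
have kerb : cfker b = cfker a by rewrite Db cfker_aut.
move: jx_in j_in; rewrite !inE.
by do 2![case/orP=> /eqP->]; rewrite ?kerb.
Qed.

Lemma irr1_ge_orbit (gT : finGroupType) (G N : {group gT})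
    (i : Iirr G) (j : Iirr N) :
    (N <| G)%g ->
  (size ('chi_j ^: G)%CF)%:R * '['Res[N] 'chi_i, 'chi_j] * 'chi_j 1%g
    <= 'chi_i 1%g.
Proof.
move=> nsNG; have [/= iNj | ] := boolP (j \in irr_constt ('Res[N] 'chi_i)).
  rewrite -[leRHS](cfRes1 N) [in leRHS](Clifford_Res_sum_cfclass nsNG iNj) cfunE.
  rewrite sum_cfunE (eq_big_seq (fun=> 'chi_j 1%g)) => [|psi]; last first.
    by case/cfclassP=> x _ ->; rewrite cfConjg1.
  by rewrite big_const_seq count_predT iter_addr_0 mulrAC [leLHS]mulrC mulr_natl.
by rewrite irr_consttE negbK => /eqP->; rewrite mulr0 mul0r char1_ge0 ?irr_char.
Qed.

(** [T(G)] is the sum of the multiplicities [e i j]. Frobenius reciprocity gives column [j] the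
    weighted sum [|G : N|] with weights ['chi_i 1]; where [e i j] is nonzero the weight can be
    traded for a factor [m] if [j != 0], but only for 1 if [j = 0]. *)
Lemma char_degree_sum_orbit_bound (gT : finGroupType) (G N : {group gT})
    (m : nat) :
    (N <| G)%g -> abelian N ->
    (forall j : Iirr N, j != 0 -> (m <= size ('chi_j ^: G)%CF)%N) ->
  m%:R * char_degree_sum G <= #|G : N|%g%:R * (m + #|N|.-1)%:R.
Proof.
move=> nsNG abN le_m; have sNG := normal_sub nsNG.
have lin_irr j : 'chi[N]_j 1%g = 1 by rewrite lin_char1 //; apply/char_abelianP.
pose e (i : Iirr G) (j : Iirr N) := '['Res[N] 'chi_i, 'chi_j].
have nat_e i j : e i j \in Num.nat.
  by rewrite Cnat_cfdot_char ?cfRes_char ?irr_char.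
have sum_e i : 'chi_i 1%g = \sum_j e i j.
  rewrite -(cfRes1 N) {1}['Res _]cfun_sum_cfdot sum_cfunE.
  by apply: eq_bigr => j _; rewrite cfunE lin_irr mulr1.
have sum_e_deg j : \sum_i e i j * 'chi_i 1%g = #|G : N|%g%:R.
  have ->: #|G : N|%g%:R = 'Ind[G] 'chi[N]_j 1%g by rewrite cfInd1 // lin_irr mulr1.
  rewrite {1}['Ind _]cfun_sum_cfdot sum_cfunE.
  apply: eq_bigr => i _; rewrite cfunE /e cfdot_Res_l cfdotC.
  by rewrite aut_natr // Cnat_cfdot_char ?cfInd_char ?irr_char.
have le_e i j (k : nat) : k%:R * e i j <= 'chi_i 1%g ->
    k%:R * e i j <= e i j * 'chi_i 1%g.
  have /natrP[[|n] ->] := nat_e i j; first by rewrite mulr0 mul0r.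
  by move/le_trans; apply; rewrite ler_peMl ?char1_ge0 ?irr_char // ler1n.
rewrite /char_degree_sum (eq_bigr _ (fun i _ => sum_e i)) exchange_big /=.
rewrite (bigD1 0) //= mulrDr natrD [leRHS]mulrDr lerD //.
  rewrite mulrC ler_wpM2r // -(sum_e_deg 0) ler_sum // => i _.
  have := le_e i 0 1%N; rewrite mul1r; apply; rewrite sum_e (bigD1 0) //= lerDl.
  by rewrite sumr_ge0 // => j _; rewrite natr_ge0.
rewrite -(card_Iirr_abelian abN) -(cardC1 (0 : Iirr N)) mulr_natr -sumr_const.
rewrite mulr_sumr ler_sum // => j nz_j; rewrite -(sum_e_deg j) mulr_sumr.
apply: ler_sum => i _; apply: le_e; apply: le_trans (irr1_ge_orbit _ _ _ i j nsNG).
by rewrite lin_irr mulr1 ler_wpM2r ?natr_ge0 // ler_nat le_m.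
Qed.

(** The series of [G / N] is pulled back to [G] and [N] is put in front; the third isomorphism
    theorem preserves the factors. *)
Lemma supersolvable_cyclic_ext (gT : finGroupType) (G N : {group gT}) :
    (N <| G)%g -> cyclic N -> supersolvable (G / N)%G -> supersolvable G.
Proof.
move=> nsNG cycN [s path_s last_s].
pose pre (K : {group coset_of N}) := (coset N @*^-1 K)%G.
have pre1 : pre 1%G = N by apply: val_inj; rewrite /= -kerE ker_coset.
have path_pre : path (supersolvable_step G) (pre 1%G) (map pre s).
  rewrite path_map; apply: sub_path path_s => H K /and4P[nsH nsK sHK cycKH].
  have nsG (L : {group coset_of N}) : (L <| G / N)%g -> (pre L <| G)%g.
    by rewrite -{2}(quotientGK nsNG) cosetpre_normal.
  have sNpre (L : {group coset_of N}) : N \subset pre L.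
    by rewrite -{1}pre1 morphpreS ?sub1G.
  apply/and4P; split; rewrite ?nsG ?morphpreS //=.
  have nsNK : (N <| pre K)%g := normalS (sNpre K) (normal_sub (nsG K nsK)) nsNG.
  have nsHK : (pre H <| pre K)%g.
    by rewrite (normalS _ (normal_sub (nsG K nsK)) (nsG H nsH)) ?morphpreS.
  have := third_isog (sNpre H) nsNK nsHK.
  by rewrite !cosetpreK => /isog_cyclic <-.
exists (N :: map pre s) => /=.
  rewrite {1}/supersolvable_step normal1 nsNG sub1G quotient_cyclic //=.
  by rewrite pre1 in path_pre.
rewrite (_ : last N _ = pre (last 1%G s)); last by rewrite -(last_map pre) pre1.
by rewrite last_s; apply: val_inj; apply: quotientGK.
Qed.

Lemma minnormal_cyclic (gT : finGroupType) (G N : {group gT}) :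
    minnormal N G -> (N <| G)%g -> 2^-1 * #|G|%:R < char_degree_sum G ->
  cyclic N.
Proof.
move=> minN nsNG hT; have [/andP[ntN _] minN'] := mingroupP minN.
have ltN'N := char_degree_sum_gt_half_der1 _ _ ntN
  (char_degree_sum_gt_half_sub _ _ _ (normal_sub nsNG) hT).
have abN : abelian N.
  rewrite (sameP derG1P eqP); apply: contraR ltN'N => ntN'; apply/eqP.
  apply: (minN' [group of N^`(1)%g]); last exact: der_sub.
  by rewrite ntN' (char_norm_trans (der_char 1 N)) ?normal_norm.
apply: contraTT hT => ncycN.
have le_T := char_degree_sum_orbit_bound _ _ _ 3 nsNG abN
  (fun j => minnormal_noncyclic_orbit _ _ _ j nsNG minN abN ncycN).
(* Groups of order 1, 2 or 3 are cyclic; the final estimate [2 (|N| + 2) <= 3 |N|] needs exactly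
   [|N| >= 4]. *)
have ge4 : (4 <= #|N|)%N.
  rewrite ltnNge; apply: contra ncycN.
  have := cardG_gt0 N; case En: #|N| => [|[|[|[|n]]]] // _ _.
  - by rewrite (card1_trivg En) cyclic1.
  - by rewrite prime_cyclic ?En.
  - by rewrite prime_cyclic ?En.
rewrite le_gtF // -(ler_pM2l (ltr0n _ 3)) (le_trans le_T) //.
rewrite mulrCA ler_pdivlMl ?ltr0n // -!natrM ler_nat -(Lagrange (normal_sub nsNG)).
by rewrite mulnCA [leqRHS]mulnA [leqRHS]mulnC leq_mul2l; lia.
Qed.

Theorem theorem4 (gT : finGroupType) (G : {group gT})
    (hT : 2^-1 * #|G|%:R < char_degree_sum G) :
  supersolvable G.
Proof.
have [n] := ubnP #|G|; elim: n => // n IHn in gT G hT *; rewrite ltnS => leGn.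
have [-> | ntG] := eqVneq G 1%G; first by exists [::].
suffices [N [nsNG cycN ntN hTN]]: exists N : {group gT},
    [/\ (N <| G)%g, cyclic N, N :!=: 1%g
      & 2^-1 * #|(G / N)%g|%:R < char_degree_sum (G / N)].
  apply: (supersolvable_cyclic_ext _ G N) => //; apply: IHn => //.
  exact: leq_trans (ltn_quotient ntN (normal_sub nsNG)) leGn.
(* For abelian [G] no nontrivial [N] lies in the derived subgroup, but any nontrivial cyclic [N]
   works: all degrees of [G / N] are 1, so its degree sum is its order. *)
have [abG | nabG] := boolP (abelian G).
  have [x Gx ntx] := trivgPn _ ntG.
  exists <[x]>%G; split; rewrite ?cycle_cyclic ?cycle_eq1 //.
    by rewrite -sub_abelian_normal ?cycle_subG.
  have abGx : abelian (G / <[x]>) by apply: quotient_abelian.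
  rewrite /char_degree_sum (eq_bigr (fun=> 1)) => [|i _]; last first.
    by rewrite lin_char1 //; apply/char_abelianP.
  rewrite sumr_const card_Iirr_abelian // -[ltRHS]mul1r.
  by rewrite ltr_pM2r ?ltr0n ?cardG_gt0 // invf_lt1 ?ltr0n ?ltr1n.
have ntG' : G^`(1)%g != 1%g by rewrite -(sameP derG1P eqP).
have [N minN sNG'] := minnormal_exists ntG' (normal_norm (der_normal 1 G)).
have [/andP[ntN nNG] _] := mingroupP minN.
have nsNG : (N <| G)%g by rewrite /normal (subset_trans sNG') ?der_sub.
exists N; split=> //; first exact: minnormal_cyclic nsNG hT.
exact: char_degree_sum_gt_half_quotient.
Qed.
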